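(* Let $(X,\overline p)$ be a perverse filtered space, with a locally finite stratification, and let $\mathrm{sd}\colon C_*(X;G)\to C_*(X;G)$ be the subdivision chain map associated to a $\mathcal T$-pseudo-barycentric system $\mathcal B$ of $X$ adapted to $\overline p$, for a simplicial system $\mathcal T$ of $X$. Then there exists a morphism $T\colon C_*(X;G)\to C_{*+1}(X;G)$ verifying $\mathrm{id}-\mathrm{sd}=T\partial+\partial T$ and such that the image by $T$ of a $\overline p$-allowable chain is a $\overline p$-allowable chain.
   Context: $G$ is a module over a Dedekind ring and $C_*(X;G)$ is the singular chain complex of $X$. Filtered spaces and perversities. A filtered space of dimension $n$ is a Hausdorff space $X$ with closed subspaces $X_0\subseteq\dots\subseteq X_{n-1}\subsetneq X_n=X$ ($X_{-1}=\emptyset$). Strata: non-empty connected components $S$ of $X_i\setminus X_{i-1}$, with $\operatorname{codim}S=n-i$; regular if $i=n$, singular otherwise. The stratification is locally finite if every point has a neighborhood that intersects only a finite number of strata. A perversity is a map $\overline p$ from the set of strata to $\mathbb Z\cup\{\pm\infty\}$, zero on regular strata; $(X,\overline p)$ is then a perverse (filtered) space. $D\overline p(S)=\operatorname{codim}S-2-\overline p(S)$ for $S$ singular. Dimension and allowability. A subset $P\subset\mathbb R^m$ is a polyhedron if each point $a\in P$ has a cone neighbourhood $a*L\subset P$ with $L$ compact. Any polyhedron is a locally finite union of simplexes $P=\bigcup_j\Delta_j$ (a triangulation of $P$), and $\dim P=\max\dim\Delta_j$. A subset $A$ of a polyhedron satisfies $\dim A\le\ell$ if $A$ is included in a polyhedron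 $Q$ with $\dim Q\le\ell$; $\dim A=k$ if $\dim A\le k$ and not $\dim A\le k-1$; $\dim\emptyset=-\infty$. A singular simplex $\sigma\colon\Delta\to X$ is $\overline p$-allowable if $\dim\sigma^{-1}S\le\dim\Delta-2-D\overline p(S)$ for each singular stratum $S$; a singular chain is $\overline p$-allowable if it can be written as a linear combination of $\overline p$-allowable simplexes. $\mathring\Delta=\Delta\setminus\partial\Delta$ (also written $\Delta^\circ$) is the interior of a simplex; $u*V=\mathtt c_uV$ is the cone on $V$ with apex $u$. Simplicial systems. For a singular simplex $\sigma\colon\Delta_\sigma\to X$ and a stratum $S$, a simplicial envelope of $\sigma^{-1}S$ is a finite family $\mathcal T_{\sigma,S}$ of Euclidean simplexes with $\sigma^{-1}S\subset\bigcup_{T\in\mathcal T_{\sigma,S}}T$ and $\dim\sigma^{-1}S=\max\{\dim T\mid T\in\mathcal T_{\sigma,S}\}$ ($\mathcal T_{\sigma,S}=\emptyset$ if $\sigma^{-1}S=\emptyset$). A simplicial system $\mathcal T$ of $X$ is a choice of an envelope $\mathcal T_{\sigma,S}$ for all $\sigma$ and $S$; $T\in\mathcal T_\sigma$ means $T\in\mathcal T_{\sigma,S}$ for some $S$. Strong general position. For Euclidean simplexes $T\subset\Delta$, $V\subset\partial\Delta$ and a point $u\in\mathring\Delta$, $\{T,\mathtt c_uV\}$ are in strong general position in $\Delta$ if either $T\cap\mathtt c_uV\subset\partial\Delta$, or both $\mathring T\cap(\mathtt c_uV)^\circ\neq\emptyset$ and $\dim(T\cap\mathtt c_uV)=\dim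 T+\dim V+1-\dim\Delta$. Pseudo-barycentric systems. A $\mathcal T$-pseudo-barycentric system $\mathcal B$ of $X$, with pseudo-barycentres $u_\sigma$, is a family of triangulations $\mathcal B_\sigma$ of $\Delta_\sigma$, one for each singular simplex $\sigma\colon\Delta_\sigma=\Delta^\ell\to X$, such that: (PB1) $u_\sigma\in\mathring\Delta_\sigma$ (so $\mathcal B_\sigma=\{u_\sigma\}$ if $\ell=0$); (PB2) for each $i$-th face $\partial_i\sigma\colon\partial_i\Delta_\sigma\to X$, $\mathcal B_{\partial_i\sigma}=\mathcal B_\sigma\cap\partial_i\Delta_\sigma$ (so there is a well-defined triangulation $\mathcal B_{\partial\sigma}$ of $\partial\Delta_\sigma$); (PB3) $\mathcal B_\sigma=u_\sigma*\mathcal B_{\partial\sigma}$ if $\ell>0$; (PB4) the maximum of the diameters of the simplexes of $\mathcal B_\sigma$ is $\le 2\ell/(2\ell+1)$; (PB5) $\{T,\mathtt c_{u_\sigma}B\}$ are in strong general position in $\Delta_\sigma$ for all $B\in\mathcal B_{\partial\sigma}$ and $T\in\mathcal T_\sigma$ (which presupposes $T\subset\Delta_\sigma$). Such a system is called here adapted to $\overline p$ if, for any $\overline p$-allowable simplex $\sigma$, the restriction of $\sigma$ to any $B\in\mathcal B_\sigma$ with $u_\sigma\in B$ is also $\overline p$-allowable; when the stratification is locally finite, adapted systems exist for every simplicial system $\mathcal T$. Associated subdivision map. $\mathrm{sd}$ is the identity in degree $0$, and inductively $\mathrm{sd}\,\sigma=u_\sigma*\mathrm{sd}(\partial\sigma)$: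 writing $\mathrm{sd}(\partial\sigma)=\sum_i n_i\,\sigma_{F_i}$ with $F_i\in\mathcal B_{\partial\sigma}$ and $\sigma_{F_i}$ the restriction of $\sigma$ to $F_i$, one puts $u_\sigma*\mathrm{sd}(\partial\sigma)=\sum_i n_i\,(u_\sigma*\sigma_{F_i})$, where $u_\sigma*\sigma_{F_i}$ is the restriction of $\sigma$ to $u_\sigma*F_i$. It is a chain map preserving $\overline p$-allowable chains. *)

(* Defs.v *)
From HB Require Import structures.
Set Warnings "-notation-overridden,-notation-incompatible-prefix,-ambiguous-paths,-redundant-canonical-projection,-projection-no-head-constant".
From mathcomp Require Import all_boot all_order all_algebra finmap fraction mxpoly.
From mathcomp Require Import all_classical all_reals all_analysis.
Import Order.TTheory GRing.Theory Num.Theory.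
Import numFieldNormedType.Exports.

Set Implicit Arguments.
Unset Strict Implicit.
Unset Printing Implicit Defensive.

Local Open Scope classical_set_scope.
Local Open Scope ring_scope.

Section Dedekind.
Variable K : idomainType.

Definition is_ideal (I : set K) : Prop :=
  [/\ I 0, forall x y, I x -> I y -> I (x + y) & forall a x, I x -> I (a * x)].

Definition ideal_span (s : seq K) : set K :=
  [set x | exists w : nat -> K, x = \sum_(i < size s) w i * s`_i].

Definition noetherian : Prop :=
  forall I, is_ideal I -> exists s, I = ideal_span s.

Definition prime_ideal (P : set K) : Prop :=
  [/\ is_ideal P, ~ P 1 & forall x y, P (x * y) -> P x \/ P y].

Definition maximal_ideal (M : set K) : Prop :=
  [/\ is_ideal M, ~ M 1 &
      forall J, is_ideal J -> M `<=` J -> J = M \/ J = [set: K]].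

Definition integrally_closed : Prop :=
  forall z : {fraction K}, integralOver (@FracField.tofrac K) z ->
    exists a : K, z = FracField.tofrac a.

(* Fields count as Dedekind rings. *)
Definition dedekind : Prop :=
  [/\ noetherian,
      forall P, prime_ideal P -> P <> [set 0] -> maximal_ideal P &
      integrally_closed].

End Dedekind.

Section Polyhedra.
Variable R : realType.

Section FixedDimension.
Variable m : nat.
Local Notation V := 'rV[R]_m.
Implicit Types (B C D T : {fset V}) (A P Q L : set V).

(* A Euclidean simplex of R^m is represented by its finite set of vertices;
   [hull B] is the underlying closed simplex. *)
Definition hull B : set V :=
  [set x | exists w : V -> R,
    [/\ forall v, v \in B -> 0 <= w v,
        \sum_(v <- B) w v = 1 &
        x = \sum_(v <- B) w v *: v]].

Definition is_simplex B : Prop :=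
  B != fset0 /\
  forall w : V -> R, \sum_(v <- B) w v = 0 -> \sum_(v <- B) w v *: v = 0 ->
    forall v, v \in B -> w v = 0.

Definition sdim B : nat := (#|` B|).-1.

Definition sdime B : \bar int := (sdim B)%:Z%:E.

Definition sboundary B : set V := \bigcup_(v in [set` B]) hull (B `\ v)%fset.

Definition sinterior B : set V := hull B `\` sboundary B.

Definition cone (a : V) L : set V :=
  [set x | x = a \/ exists2 b, L b &
    exists2 t : R, 0 <= t <= 1 & x = (1 - t) *: a + t *: b].

(* Every point of the cone other than the apex lies on a unique segment [a, b]
   with b in L, at a unique place; in particular a is not in L. *)
Definition is_cone (a : V) L : Prop :=
  forall b b' t t', L b -> L b' -> 0 < t <= 1 -> 0 < t' <= 1 ->
    (1 - t) *: a + t *: b = (1 - t') *: a + t' *: b' -> b = b' /\ t = t'.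

Definition polyhedron P : Prop :=
  forall a, P a -> exists L,
    [/\ compact L, is_cone a L, cone a L `<=` P & within P (nbhs a) (cone a L)].

Definition triangulation (K : set {fset V}) P : Prop :=
  [/\ K `<=` is_simplex,
      P = \bigcup_(B in K) hull B &
      forall x, P x -> exists2 U, nbhs x U &
        finite_set [set B | K B /\ hull B `&` U !=set0]].

Definition polyhedron_dim_le P (d : \bar int) : Prop :=
  polyhedron P /\
  exists2 K, triangulation K P & forall B, K B -> (sdime B <= d)%E.

Definition dim_le A (d : \bar int) : Prop :=
  exists2 Q, A `<=` Q & polyhedron_dim_le Q d.

Definition has_dim A (d : \bar int) : Prop :=
  match d with
  | k%:E => dim_le A k%:E /\ ~ dim_le A (k - 1)%:E
  | -oo%E => A = set0
  | +oo%E => False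
  end.

(* The family is empty exactly when A is: the maximum is then -oo. *)
Definition envelope A (F : seq {fset V}) : Prop :=
  [/\ forall T, T \in F -> is_simplex T,
      A `<=` \bigcup_(T in [set` F]) hull T &
      has_dim A (\big[Order.max/-oo%E]_(T <- F) sdime T)].

Definition strong_general_position D T C (u : V) : Prop :=
  [/\ hull T `<=` hull D, hull C `<=` sboundary D, sinterior D u &
      hull T `&` hull (u |` C)%fset `<=` sboundary D \/
      (sinterior T `&` sinterior (u |` C)%fset !=set0 /\
       has_dim (hull T `&` hull (u |` C)%fset)
         ((sdim T)%:Z + (sdim C)%:Z + 1 - (sdim D)%:Z)%:E)].

Definition simplicial_complex (K : set {fset V}) : Prop :=
  [/\ K `<=` is_simplex,
      forall B C, K B -> C != fset0 -> (C `<=` B)%fset -> K C &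
      forall B C, K B -> K C -> hull B `&` hull C = hull (B `&` C)%fset].

(* u * K as a simplicial complex: the apex, the simplexes of K, and their
   cones. *)
Definition cone_complex (u : V) (K : set {fset V}) : set {fset V} :=
  [set [fset u]%fset] `|` K `|` [set (u |` B)%fset | B in K].

(* The Euclidean distance, scaled by 1/sqrt 2 so that the edges of the standard
   simplexes have length 1. *)
Definition edist (x y : V) : R :=
  Num.sqrt ((\sum_i (x 0 i - y 0 i) ^+ 2) / 2).

Definition diameter A : R := sup [set edist x y | x in A & y in A].

End FixedDimension.

Definition stdsimplex (l : nat) : set 'rV[R]_l.+1 :=
  [set x | (forall i, 0 <= x 0 i) /\ \sum_i x 0 i = 1].
Arguments stdsimplex : clear implicits.

Definition std_vertices (l : nat) : {fset 'rV[R]_l.+1} :=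
  [fset delta_mx 0 i | i in 'I_l.+1]%fset.

Lemma hull_std_vertices l : hull (std_vertices l) = stdsimplex l.
Proof.
have inj : {in enum 'I_l.+1 &, injective (fun i => delta_mx 0 i : 'rV[R]_l.+1)}.
  move=> i j _ _ /matrixP /(_ 0 i); rewrite !mxE !eqxx /=.
  by case: eqP => // _ /eqP; rewrite oner_eq0.
have bigE (W : nmodType) (F : 'rV[R]_l.+1 -> W) :
    \sum_(v <- std_vertices l) F v = \sum_i F (delta_mx 0 i).
  transitivity (\sum_(v <- [seq delta_mx 0 i : 'rV[R]_l.+1 | i <- enum 'I_l.+1]) F v).
    apply: perm_big; apply: uniq_perm; first exact: fset_uniq.
      by rewrite map_inj_in_uniq ?enum_uniq.
    move=> v; apply/imfsetP/mapP => -[i ? ->]; exists i => //=.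
    by rewrite mem_enum.
  by rewrite big_map big_enum.
apply/seteqP; split => [x [w [w0 w1 ->]]|x [x0 x1]].
  move: w1; rewrite !bigE => w1.
  have E i : (\sum_j w (delta_mx 0 j) *: (delta_mx 0 j : 'rV[R]_l.+1)) 0 i
             = w (delta_mx 0 i).
    rewrite summxE (bigD1 i) //= !mxE !eqxx mulr1 big1 ?addr0 // => j ji.
    by rewrite !mxE eqxx eq_sym (negbTE ji) mulr0.
  split=> [i|]; last by rewrite -w1; apply: eq_bigr => i _; rewrite E.
  by rewrite E; apply: w0; apply/imfsetP; exists i.
exists (fun v => \sum_i x 0 i * v 0 i); rewrite !bigE.
have E i : \sum_j x 0 j * (delta_mx 0 i : 'rV[R]_l.+1) 0 j = x 0 i.
  rewrite (bigD1 i) //= mxE !eqxx mulr1 big1 ?addr0 // => j ji.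
  by rewrite mxE (negbTE ji) andbF mulr0.
split=> [v /imfsetP[i _ ->]||]; first by rewrite E.
  by rewrite -x1; apply: eq_bigr => i _; rewrite E.
by under eq_bigr do rewrite E; exact: row_sum_delta.
Qed.

(* The linear map sending the i-th vertex of the standard simplex to v i. *)
Definition lincomb (k m : nat) (v : 'I_k.+1 -> 'rV[R]_m) (t : 'rV[R]_k.+1) :
  'rV[R]_m := \sum_i t 0 i *: v i.

Definition face_map (l : nat) (i : 'I_l.+2) : 'rV[R]_l.+1 -> 'rV[R]_l.+2 :=
  lincomb (fun j => delta_mx 0 (lift i j)).

Lemma lincomb_std k l (v : 'I_k.+1 -> stdsimplex l) (t : stdsimplex k) :
  lincomb (val \o v) (val t) \in stdsimplex l.
Proof.
have [t0 t1] := set_valP t; apply: mem_set; split=> [i|].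
  rewrite summxE sumr_ge0 // => j _; rewrite mxE mulr_ge0 //.
  by have [+ _] := set_valP (v j); apply.
rewrite -t1 (eq_bigr (fun i => \sum_j (val t) 0 j * (val (v j)) 0 i)).
  rewrite exchange_big /=; apply: eq_bigr => j _; rewrite -mulr_sumr.
  by have [_ ->] := set_valP (v j); rewrite mulr1.
by move=> i _; rewrite summxE; apply: eq_bigr => j _; rewrite mxE.
Qed.

Definition affine_map k l (v : 'I_k.+1 -> stdsimplex l) (t : stdsimplex k) :
  stdsimplex l := SigSub (lincomb_std v t).

Lemma continuous_affine_map k l (v : 'I_k.+1 -> stdsimplex l) :
  continuous (affine_map v).
Proof.
have cval : continuous (val : stdsimplex k -> 'rV[R]_k.+1).
  have := @initial_continuous (stdsimplex k) _ set_val.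
  by rewrite set_valE.
apply: (@continuous_comp_initial _ _ _ set_val); rewrite set_valE.
suff : continuous (fun t : stdsimplex k => \sum_i (val t) 0 i *: val (v i)) by [].
apply: continuous_big => [|i _ t]; first exact: add_continuous.
apply: cvgZr_tmp; first exact: (nbhs_filter t).
apply: (@cvg_comp _ _ _ val (fun x : 'rV[R]_k.+1 => x 0 i)); first exact: cval.
exact: coord_continuous.
Qed.

HB.instance Definition _ k l (v : 'I_k.+1 -> stdsimplex l) :=
  @isContinuous.Build _ _ (affine_map v) (@continuous_affine_map k l v).

Lemma vertex_subproof l (i : 'I_l.+1) : delta_mx 0 i \in stdsimplex l.
Proof.
apply: mem_set; rewrite -hull_std_vertices.
exists (fun v => (v == delta_mx 0 i)%:R).
have iV : delta_mx 0 i \in std_vertices l by apply/imfsetP; exists i.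
split=> [v _||]; first by rewrite ler0n.
  by rewrite (big_fsetD1 _ iV) /= eqxx big_seq big1 ?addr0 // => v;
    rewrite !inE => /andP[/negbTE ->].
by rewrite (big_fsetD1 _ iV) /= eqxx scale1r big_seq big1 ?addr0 // => v;
  rewrite !inE => /andP[/negbTE ->]; rewrite scale0r.
Qed.

Definition vertex l (i : 'I_l.+1) : stdsimplex l := SigSub (vertex_subproof i).

Section Filtered.
Variable X : topologicalType.

Definition pred_skeleton (sk : nat -> set X) (i : nat) : set X :=
  if i is j.+1 then sk j else set0.

(* The skeleta beyond the dimension are forced to be the whole space. *)
Record filtered_space := FilteredSpace {
  fdim : nat;
  skeleton : nat -> set X;
  filtered_hausdorff : hausdorff_space X;
  skeleton_closed : forall i, closed (skeleton i);
  skeleton_mono : forall i j, (i <= j)%N -> skeleton i `<=` skeleton j;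
  skeleton_fdim : skeleton fdim = [set: X];
  skeleton_proper : pred_skeleton skeleton fdim <> [set: X] }.

Variable F : filtered_space.

Definition skeleton_diff (i : nat) : set X :=
  skeleton F i `\` pred_skeleton (skeleton F) i.

Record stratum := Stratum {
  level : nat;
  stratum_set :> set X;
  level_le : (level <= fdim F)%N;
  stratum_component : exists2 x, skeleton_diff level x &
        stratum_set = connected_component (skeleton_diff level) x }.

Definition codim (S : stratum) : nat := (fdim F - level S)%N.
Definition regular (S : stratum) : Prop := level S = fdim F.
Definition singular (S : stratum) : Prop := ~ regular S.

Definition locally_finite : Prop :=
  forall x : X, exists2 U, nbhs x U &
    finite_set [set S : stratum | stratum_set S `&` U !=set0].

Record perversity := Perversity {
  perv :> stratum -> \bar int;
  perv_regular : forall S, regular S -> perv S = 0%E }.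

Definition dual_perversity (p : perversity) (S : stratum) : \bar int :=
  ((codim S)%:Z%:E - 2%:Z%:E - p S)%E.

Definition sing (l : nat) := continuousType (stdsimplex l) X.

(* The restriction of s to the simplex with ordered vertices v 0, ..., v k
   (possibly degenerate), as a singular k-simplex. *)
Definition restr k l (s : sing l) (v : 'I_k.+1 -> stdsimplex l) : sing k :=
  s \o affine_map v.

Definition face l (s : sing l.+1) (i : 'I_l.+2) : sing l :=
  restr s (fun j => vertex (lift i j)).

Definition preim_stratum l (s : sing l) (S : stratum) : set 'rV[R]_l.+1 :=
  [set val t | t in [set t : stdsimplex l | stratum_set S (s t)]].

Definition allowable (p : perversity) l (s : sing l) : Prop :=
  forall S, singular S ->
    dim_le (preim_stratum s S)
      (l%:Z%:E - 2%:Z%:E - dual_perversity p S)%E.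

Section Chains.
Variables (K : idomainType) (G : lmodType K).

Section FixedDegree.
Variable l : nat.

Definition fin_supp : {pred sing l -> G} :=
  [pred c | `[< finite_set [set s | c s != 0] >]].

Lemma fin_supp_submod : submod_closed fin_supp.
Proof.
have E (c : sing l -> G) : finite_set [set s | c s != 0] <-> c \in fin_supp.
  exact: (rwP (asboolP _)).
split=> [|a c d].
  by apply/E/(@sub_finite_set _ _ set0) => // s /=; rewrite eqxx.
move=> /E fc /E fd; apply/E.
apply: (@sub_finite_set _ _ ([set s | c s != 0] `|` [set s | d s != 0])).
  move=> s; rewrite /mkset -[(a *: c + d) s]/(a *: c s + d s) /=.
  have [->|] := eqVneq (c s) 0; last by left.
  have [-> |] := eqVneq (d s) 0; last by right.
  by rewrite scaler0 addr0 eqxx.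
by rewrite finite_setU.
Qed.

HB.instance Definition _ :=
  GRing.isSubmodClosed.Build K (sing l -> G) fin_supp fin_supp_submod.

(* C_l(X; G): finitely supported families of coefficients in G. *)
Record chain := Chain { chain_fun :> sing l -> G; _ : chain_fun \in fin_supp }.

HB.instance Definition _ := [isSub for chain_fun].
HB.instance Definition _ := [Choice of chain by <:].
HB.instance Definition _ := [SubChoice_isSubLmodule of chain by <:].

Lemma single_subproof (s : sing l) (g : G) :
  (fun s' => if s' == s then g else 0) \in fin_supp.
Proof.
apply/asboolP/(@sub_finite_set _ _ [set s]) => [s' /=|]; last exact: finite_set1.
by case: (s' =P s) => // _; rewrite eqxx.
Qed.

Definition single (s : sing l) (g : G) : chain := Chain (single_subproof s g).

Definition allowable_chain (p : perversity) (c : chain) : Prop :=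
  exists cs : seq (G * sing l),
    (forall gs, gs \in cs -> allowable p gs.2) /\
    c = \sum_(gs <- cs) single gs.2 gs.1.

End FixedDegree.

Definition boundary l (c : chain l.+1) : chain l :=
  \sum_(s \in [set: sing l.+1])
    \sum_(i < l.+2) single (face s i) ((-1) ^+ i *: c s).

End Chains.

Record simplicial_system := SimplicialSystem {
  env :> forall l, sing l -> stratum -> seq {fset 'rV[R]_l.+1};
  envP : forall l (s : sing l) (S : stratum),
    envelope (preim_stratum s S) (env s S) }.

Section BoundaryTriangulation.
Variable tri : forall l, sing l -> set {fset 'rV[R]_l.+1}.

Definition face_tri l (s : sing l.+1) (i : 'I_l.+2) : set {fset 'rV[R]_l.+2} :=
  [set [fset face_map i x | x in B]%fset | B in tri (face s i)].

Definition boundary_tri l (s : sing l.+1) : set {fset 'rV[R]_l.+2} :=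
  \bigcup_i face_tri s i.

End BoundaryTriangulation.

Record pseudo_barycentric_system (T : simplicial_system) :=
  PseudoBarycentricSystem {
  tri : forall l, sing l -> set {fset 'rV[R]_l.+1};
  pbary : forall l, sing l -> stdsimplex l;
  tri_triangulation : forall l (s : sing l),
    simplicial_complex (tri s) /\ triangulation (tri s) (stdsimplex l);
  pbary_interior : forall l (s : sing l), sinterior (std_vertices l) (val (pbary s));
  tri_face : forall l (s : sing l.+1) (i : 'I_l.+2),
    face_tri tri s i =
    [set B | tri s B /\ hull B `<=` face_map i @` stdsimplex l];
  tri_cone : forall l (s : sing l.+1),
    tri s = cone_complex (val (pbary s)) (boundary_tri tri s);
  tri_mesh : forall l (s : sing l) B, tri s B ->
    diameter (hull B) <= (2 * l)%N%:R / (2 * l).+1%:R;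
  tri_general_position : forall l (s : sing l.+1) B C (S : stratum),
    boundary_tri tri s B -> C \in T l.+1 s S ->
    strong_general_position (std_vertices l.+1) C B (val (pbary s)) }.

(* The restriction of s to B is taken with respect to every ordering
   v 0, ..., v k of the vertices of B. *)
Definition adapted (p : perversity) T (B : pseudo_barycentric_system T) : Prop :=
  forall l (s : sing l), allowable p s ->
  forall k (v : 'I_k.+1 -> stdsimplex l), injective v ->
    tri B s [fset val (v i) | i in 'I_k.+1]%fset ->
    (exists i, v i = pbary B s) -> allowable p (restr s v).

Section Subdivision.
Variables (u : forall l, sing l -> stdsimplex l).

(* The vertices of the join of a point with an ordered simplex. *)
Definition join k l (a : stdsimplex l) (v : 'I_k.+1 -> stdsimplex l)
    (i : 'I_k.+2) : stdsimplex l :=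
  if unlift ord0 i is Some j then v j else a.

Definition cone_face l (a : stdsimplex l.+1) (i : 'I_l.+2)
    (nF : int * ('I_l.+1 -> stdsimplex l)) :
    int * ('I_l.+2 -> stdsimplex l.+1) :=
  ((-1) ^+ (nat_of_ord i) * nF.1,
   join a (affine_map (fun j : 'I_l.+1 => vertex (lift i j)) \o nF.2)).

(* The signed ordered simplexes (n, F) such that sd s is the sum of the n s_F.
   Simplexes of the subdivision of the i-th face are first moved into the
   domain of s by the i-th face inclusion. *)
Fixpoint sd_simplexes l : sing l -> seq (int * ('I_l.+1 -> stdsimplex l)) :=
  match l with
  | 0 => fun _ => [:: (1, @vertex 0)]
  | l'.+1 => fun s : sing l'.+1 =>
      flatten [seq map (cone_face (u s) i) (sd_simplexes (face s i))
                 | i : 'I_l'.+2 <- enum 'I_l'.+2]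
  end.

Definition sd (K : idomainType) (G : lmodType K) l (c : chain G l) : chain G l :=
  \sum_(s \in [set: sing l])
    \sum_(nF <- sd_simplexes s) single (restr s nF.2) (c s *~ nF.1).

End Subdivision.

End Filtered.
End Polyhedra.

Arguments stdsimplex R l : clear implicits.
Arguments std_vertices R l : clear implicits.
Arguments sing R X l : clear implicits.
Arguments chain R X {K} G l.
Arguments simplicial_system R {X} F.
Arguments pbary {R X F T} B l s : rename.

(* Main.v *)
From HB Require Import structures.
Require Import Defs.
From mathcomp Require Import all_boot all_order all_algebra.
From mathcomp Require Import finmap.
From mathcomp Require Import all_classical all_reals all_analysis.
From mathcomp Require Import zify lra.
Import Order.TTheory GRing.Theory Num.Theory.
Import numFieldNormedType.Exports.

Set Implicit Arguments.
Unset Strict Implicit.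
Unset Printing Implicit Defensive.

Local Open Scope classical_set_scope.
Local Open Scope ring_scope.

(** The homotopy is the classical one for iterated cone subdivisions. On a
    singular simplex s of dimension l > 0 with pseudo-barycentre u, put

      H s = u * (s - H (d s)),

    and H = 0 in degree 0. Since d (u * c) = c - u * d c, an induction on the
    degree gives d (H s) = s - sd s - H (d s): the induction hypothesis, applied
    to the faces of s, turns u * d (s - H (d s)) into u * sd (d s) + u * H (d (d s)),
    and H (d (d s)) = 0.

    The cone with apex u lives in the domain of s and not in X, so this
    computation takes place among formal combinations of affine simplexes in the
    standard simplex. Two such combinations are compared through their pairings
    with all cochains ([pairing]), the boundary being replaced by its transpose
    ([coboundary]); the outcome is [homotopy_coboundary]. Evaluating on the
    cochain that restricts s yields the chain homotopy [homotopyE].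

    For allowability, every term of H s is s composed with an affine map
    from the simplex of dimension l + 1 to that of dimension l. As the
    pseudo-barycentre is interior to the domain, an induction over the faces
    shows that the vertices of this map span the vector space around the target
    ([homotopy_simplexes_spanning]), hence that its fibres are at most lines.
    Pulling back along it therefore raises the dimension of a subset by at most 1,
    which is exactly how much the bound in the definition of allowability grows
    when l is replaced by l + 1 ([allowable_restr]).

    The preimage of s^-1 S is bounded in dimension as follows. The envelope of
    s^-1 S covers it by finitely many simplexes, whose dimensions obey the bound
    that allowability gives ([envelope_simplexes]). The part of the standard
    simplex above one of them is a bounded subset of an affine space of one more
    dimension, hence sits inside a single simplex of that dimension
    ([simplex_preimage]). Finally a finite union of simplexes is a polyhedron
    ([union_polyhedron]): radial segments issued from a point of a simplex can be
    prolonged up to a fixed distance inside it, because barycentric coordinates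
    are Lipschitz. *)

(** * Linear maps on singular chains *)

Section Chains.
Variables (R : realType) (X : topologicalType).
Variables (K : idomainType) (G : lmodType K).
Implicit Types (k l : nat).

Lemma chain_linE l (a : K) (c d : chain R X G l) s :
  (a *: c + d) s = a *: c s + d s.
Proof. by []. Qed.

Lemma single_linear l (s : sing R X l) : linear (@single R X K G l s).
Proof.
move=> a g h; apply/val_inj/funext => s' /=.
change ((if s' == s then a *: g + h else 0) =
  a *: (if s' == s then g else 0) + (if s' == s then h else 0)).
by case: ifP => // _; rewrite scaler0 addr0.
Qed.

HB.instance Definition _ l (s : sing R X l) :=
  GRing.isLinear.Build K G (chain R X G l) _ (@single R X K G l s)
    (single_linear s).

Section Extension.
Variables (l : nat) (W : lmodType K) (f : sing R X l -> G -> W).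
Hypothesis f_linear : forall s, linear (f s).

(** The boundary, the subdivision and the homotopy all have this shape: the sum
    of a linear function of the coefficient of each simplex. *)
Definition extension (c : chain R X G l) : W :=
  \sum_(s \in [set: sing R X l]) f s (c s).

Let f0 s : f s 0 = 0.
Proof. by have := f_linear s (-1) 0 0; rewrite scaler0 addr0 scaleN1r addNr. Qed.

Lemma chain_support (c : chain R X G l) : finite_set [set s | c s != 0].
Proof. by apply/asboolP; case: c. Qed.

Lemma extensionE (c : chain R X G l) (A : {fset sing R X l}) :
  [set s | c s != 0] `<=` [set` A] -> extension c = \sum_(s <- A) f s (c s).
Proof.
move=> cA; rewrite /extension (fsbigTE A) // => s sA.
have [->|cs] := eqVneq (c s) 0; first exact: f0.
by have /= := cA s cs; rewrite (negbTE sA).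
Qed.

Lemma extension_linear : linear extension.
Proof.
move=> a c d.
pose A := fset_set ([set s | c s != 0] `|` [set s | d s != 0]).
have fA : finite_set ([set s | c s != 0] `|` [set s | d s != 0]).
  by rewrite finite_setU; split; exact: chain_support.
have EA : [set` A] = [set s | c s != 0] `|` [set s | d s != 0].
  exact: fset_setK.
rewrite !(@extensionE _ A) ?EA; last 3 first.
- by move=> s; right.
- by move=> s; left.
- move=> s; rewrite /mkset chain_linE.
  have [->|] := eqVneq (c s) 0; last by left.
  have [->|] := eqVneq (d s) 0; last by right.
  by rewrite scaler0 addr0 eqxx.
rewrite scaler_sumr -big_split; apply: eq_bigr => s _.
by rewrite chain_linE f_linear.
Qed.

Lemma extension_single s g : extension (single s g) = f s g.
Proof.
rewrite (@extensionE _ [fset s]%fset) ?big_seq_fset1 /= ?eqxx // => t /=.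
by rewrite inE; case: (t == s); rewrite ?eqxx.
Qed.

End Extension.

(** This reduces an equality of additive maps to the case of one simplex with
    one coefficient. *)
Lemma chain_single_ind l (P : chain R X G l -> Prop) :
  P 0 -> (forall s g c, P c -> P (single s g + c)) -> forall c, P c.
Proof.
move=> P0 PD c.
suff -> : c = \sum_(s <- fset_set [set s | c s != 0]) single s (c s).
  by elim/big_rec: _ => // s d _ Pd; exact: PD.
rewrite -(@extensionE _ _ (fun s => @single R X K G l s)); first last.
- by rewrite fset_setK; [move=> s|exact: chain_support].
- by move=> s; exact: single_linear.
apply/val_inj/funext => t.
rewrite (@extensionE _ _ (fun s => @single R X K G l s) _ _
           (t |` fset_set [set s | c s != 0])%fset); first last.
- move=> s cs /=; rewrite !inE in_fset_set; last exact: chain_support.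
  by rewrite mem_set ?orbT.
- by move=> s; exact: single_linear.
have E (A : seq (sing R X l)) : (\sum_(s <- A) single s (c s) : chain R X G l) t =
    \sum_(s <- A) (single s (c s) : chain R X G l) t.
  elim: A => [|s A IH]; first by rewrite !big_nil.
  rewrite !big_cons -IH //.
rewrite [RHS]E (bigD1_seq t) ?fset_uniq //=; last by rewrite !inE eqxx.
rewrite eqxx big1 ?addr0 // => s; rewrite eq_sym; by case: eqP.
Qed.

End Chains.

(** * Formal chains of affine simplexes and the prism identity *)

Section Prism.
Variables (R : realType) (X : topologicalType).
Implicit Types (k l : nat).

Local Notation cell k l := ('I_k.+1 -> stdsimplex R l).

(** A list of signed ordered simplexes stands for a formal chain. Lists are never
    compared directly: two of them are the same formal chain exactly when they
    pair equally with every cochain, in any abelian group of values. *)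
Definition pairing k l (W : zmodType) (L : seq (int * cell k l))
  (phi : cell k l -> W) : W := \sum_(nv <- L) phi nv.2 *~ nv.1.

Definition coboundary k l (W : zmodType) (phi : cell k l -> W)
  (v : cell k.+1 l) : W := \sum_(i < k.+2) phi (v \o lift i) *~ (-1) ^+ i.

Definition push_face k l (i : 'I_l.+2) (v : cell k l) : cell k l.+1 :=
  affine_map (fun j => vertex R (lift i j)) \o v.

Definition push_formal k l (i : 'I_l.+2) (L : seq (int * cell k l)) :
    seq (int * cell k l.+1) :=
  [seq ((-1) ^+ i * nv.1, push_face i nv.2) | nv <- L].

Section Pairing.
Variables (k l : nat) (W : zmodType).
Implicit Types (L : seq (int * cell k l)).

Lemma pairing_cat L L' (phi : cell k l -> W) :
  pairing (L ++ L') phi = pairing L phi + pairing L' phi.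
Proof. exact: big_cat. Qed.

Lemma pairing_flatten (I : Type) (r : seq I) (L : I -> seq (int * cell k l))
    (phi : cell k l -> W) :
  pairing (flatten [seq L i | i <- r]) phi = \sum_(i <- r) pairing (L i) phi.
Proof.
elim: r => [|i r IH] /=; first by rewrite /pairing !big_nil.
by rewrite pairing_cat IH big_cons.
Qed.

Lemma pairing_map k' l' (e : int) (g : cell k l -> cell k' l') L
    (phi : cell k' l' -> W) :
  pairing [seq (e * nv.1, g nv.2) | nv <- L] phi = pairing L (phi \o g) *~ e.
Proof.
rewrite /pairing big_map mulrz_suml; apply: eq_bigr => nv _ /=.
by rewrite mulrC mulrzA.
Qed.

Lemma pairing_sub L (phi psi : cell k l -> W) :
  pairing L (fun v => phi v - psi v) = pairing L phi - pairing L psi.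
Proof.
by rewrite /pairing -sumrB; apply: eq_bigr => nv _; rewrite mulrzBl.
Qed.

End Pairing.

Lemma join_lift0 k l (a : stdsimplex R l) (v : cell k l) :
  join a v \o lift ord0 = v.
Proof. by apply/funext => j; rewrite /= /join liftK. Qed.

Lemma join_lift k l (a : stdsimplex R l) (v : cell k.+1 l) (i : 'I_k.+2) :
  join a v \o lift (lift ord0 i) = join a (v \o lift i).
Proof.
apply/funext => j; rewrite /= /join.
case: (unliftP ord0 j) => [j'|] -> /=.
  have -> : lift (lift ord0 i) (lift ord0 j') = lift ord0 (lift i j').
    by apply: val_inj; rewrite /= /bump /=; lia.
  by rewrite !liftK.
have -> : lift (lift ord0 i) ord0 = ord0 :> 'I_k.+3.
  by apply: val_inj; rewrite /= /bump /=.
by rewrite unlift_none.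
Qed.

(** The transpose of d (u * c) = c - u * d c, which holds for c of positive
    dimension. *)
Lemma coboundary_join k l (W : zmodType) (a : stdsimplex R l)
    (phi : cell k.+1 l -> W) (v : cell k.+1 l) :
  coboundary phi (join a v) = phi v - coboundary (phi \o join a) v.
Proof.
rewrite /coboundary big_ord_recl expr0 mulr1z join_lift0; congr (_ + _).
rewrite -sumrN; apply: eq_bigr => i _.
by rewrite join_lift /= exprS mulN1r mulrNz.
Qed.

Lemma affine_map_vertex k l (v : cell k l) (i : 'I_k.+1) :
  affine_map v (vertex R i) = v i.
Proof.
apply: val_inj => /=; rewrite /lincomb (bigD1 i) //= mxE !eqxx scale1r.
rewrite big1 ?addr0 // => j ji.
by rewrite mxE (negbTE ji) andbF scale0r.
Qed.

Lemma affine_map_comp k l m (v : cell l m) (w : cell k l) t :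
  affine_map v (affine_map w t) = affine_map (affine_map v \o w) t.
Proof.
apply: val_inj => /=; rewrite /lincomb.
under [RHS]eq_bigr do rewrite /= /lincomb scaler_sumr.
rewrite exchange_big; apply: eq_bigr => i _ /=.
rewrite summxE scaler_suml; apply: eq_bigr => j _.
by rewrite mxE scalerA.
Qed.

Lemma push_vertex l (i : 'I_l.+2) :
  push_face i (@vertex R l) = @vertex R l.+1 \o lift i.
Proof. by apply/funext => j; rewrite /push_face /= affine_map_vertex. Qed.

Lemma coboundary_push k l (W : zmodType) (i : 'I_l.+2)
    (phi : cell k l.+1 -> W) :
  coboundary phi \o push_face i = coboundary (phi \o push_face i).
Proof. by []. Qed.

Lemma restr_comp k l m (s : sing R X m) (v : cell l m) (w : cell k l) :
  restr (restr s v) w = restr s (affine_map v \o w).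
Proof. by apply/continuousEP => t /=; rewrite affine_map_comp. Qed.

Lemma restr_vertex l (s : sing R X l) : restr s (@vertex R l) = s.
Proof.
apply/continuousEP => t /=; congr (s _); apply: val_inj => /=.
by rewrite /lincomb [RHS]row_sum_delta.
Qed.

(** The cancellation behind d d = 0. A pair (i, j) stands for omitting first the
    vertex i and then the vertex j of what remains, that is the vertex [lift i j];
    each set of two omitted vertices arises twice, with opposite signs. The terms are
    matched explicitly, since in a group with 2-torsion it is not enough that
    the sum be equal to its opposite. *)
Lemma alternating_sum_pairs n (W : zmodType)
    (g : 'I_n.+1 -> 'I_n -> W) :
  (forall i j i' j', i' = lift i j -> i = lift i' j' -> g i j = g i' j') ->
  \sum_(i < n.+1) \sum_(j < n) g i j *~ (-1) ^+ (i + j) = 0.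
Proof.
move=> g_sym.
(* The sum reindexed by the ordered pairs of omitted vertices *)
pose h i i' := if unlift i i' is Some j then g i j *~ (-1) ^+ (i + j) else 0.
have hE i : \sum_(j < n) g i j *~ (-1) ^+ (i + j) = \sum_(i' < n.+1) h i i'.
  rewrite (bigD1_ord i) //= /h unlift_none add0r.
  by apply: eq_bigr => j _; rewrite liftK.
have h_anti (i i' : 'I_n.+1) : (i < i')%N -> h i i' + h i' i = 0.
  move=> lt_ii'; rewrite /h.
  have ne : i != i' by rewrite -val_eqE /= ltn_eqF.
  have [[j lt_jn] Ej ->] := unlift_some ne.
  have ne' : i' != i by rewrite eq_sym.
  have [[j' lt_jn'] Ej' ->] := unlift_some ne'.
  rewrite (g_sym _ _ _ _ Ej Ej') /=.
  have -> : (-1) ^+ (i + j) = - (-1) ^+ (i' + j') :> int.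
    have := congr1 (@nat_of_ord _) Ej; have := congr1 (@nat_of_ord _) Ej';
      rewrite /= /bump => E1 E2.
    have [Ea Eb] : i' = j.+1 :> nat /\ i = j' :> nat by lia.
    by rewrite Ea -Eb addSn exprS mulN1r opprK addnC.
  by rewrite mulrNz addNr.
under eq_bigr do rewrite hE.
pose lt_sum (f : 'I_n.+1 -> 'I_n.+1 -> W) :=
  \sum_(i < n.+1) \sum_(i' < n.+1) if (i < i')%N then f i i' else 0.
transitivity (lt_sum h + lt_sum (fun i i' => h i' i)).
  rewrite /lt_sum [X in _ + X]exchange_big /= -big_split /=.
  apply: eq_bigr => i _; rewrite -big_split /=; apply: eq_bigr => i' _.
  case: ltngtP => [_|_|/val_inj ->]; rewrite ?addr0 ?add0r //.
  by rewrite /h unlift_none.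
rewrite -big_split big1 // => i _; rewrite -big_split big1 // => i' _ /=.
by case: ifP => [/h_anti|]; rewrite ?addr0.
Qed.

Section Homotopy.
Variable u : forall l, sing R X l -> stdsimplex R l.

(** The terms of u * (s - H (d s)), as affine simplexes in the domain of s. The
    flattened list in the recursive call is H (d s), named [face_homotopy] once
    the recursion is closed. *)
Fixpoint homotopy_simplexes l : sing R X l -> seq (int * cell l.+1 l) :=
  match l with
  | 0 => fun=> [::]
  | l'.+1 => fun s : sing R X l'.+1 =>
      (1, join (u s) (@vertex R l'.+1)) ::
      [seq (-1 * nv.1, join (u s) nv.2) | nv <-
        flatten [seq push_formal i (homotopy_simplexes (face s i))
                   | i : 'I_l'.+2 <- enum 'I_l'.+2]]
  end.

Definition face_homotopy l (s : sing R X l.+1) : seq (int * cell l.+1 l.+1) :=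
  flatten [seq push_formal i (homotopy_simplexes (face s i))
             | i : 'I_l.+2 <- enum 'I_l.+2].

Lemma pairing_face_homotopy l (s : sing R X l.+1) (W : zmodType)
    (phi : cell l.+1 l.+1 -> W) :
  pairing (face_homotopy s) phi =
  \sum_i pairing (homotopy_simplexes (face s i)) (phi \o push_face i) *~ (-1) ^+ i.
Proof.
rewrite /face_homotopy pairing_flatten big_enum /=.
by apply: eq_bigr => i _; rewrite /push_formal pairing_map.
Qed.

Lemma pairing_homotopy l (s : sing R X l.+1) (W : zmodType)
    (phi : cell l.+2 l.+1 -> W) :
  pairing (homotopy_simplexes s) phi =
  phi (join (u s) (@vertex R l.+1)) -
  pairing (face_homotopy s) (phi \o join (u s)).
Proof.
by rewrite /= {1}/pairing big_cons mulr1z -[X in _ + X]/(pairing _ _) pairing_map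
  mulrN1z.
Qed.

Lemma pairing_sd l (s : sing R X l.+1) (W : zmodType)
    (phi : cell l.+1 l.+1 -> W) :
  pairing (sd_simplexes u s) phi =
  \sum_i pairing (sd_simplexes u (face s i)) (phi \o join (u s) \o push_face i)
     *~ (-1) ^+ i.
Proof.
rewrite /= pairing_flatten big_enum /=; apply: eq_bigr => i _.
exact: (pairing_map _ (join (u s) \o push_face i)).
Qed.

(** H (d (d s)) = 0, the homotopies of the faces being pushed into the domain of
    s. This is not an instance of d d = 0 on formal chains: it uses that the value
    of [homotopy_simplexes] on an iterated face depends only on which face it is. *)
Lemma face_homotopy_faces l (s : sing R X l.+2) (W : zmodType)
    (phi : cell l.+1 l.+2 -> W) :
  \sum_i pairing (face_homotopy (face s i)) (phi \o push_face i) *~ (-1) ^+ i = 0.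
Proof.
under eq_bigr => i _.
  rewrite pairing_face_homotopy mulrz_suml.
  under eq_bigr do rewrite -mulrzA -exprD addnC.
  over.
apply: (@alternating_sum_pairs _ _ (fun i j =>
  pairing (homotopy_simplexes (face (face s i) j))
    (phi \o push_face i \o push_face j))).
move=> i [j lt_j] i' [j' lt_j'] Ei' Ei.
set jo := Ordinal lt_j; set jo' := Ordinal lt_j'.
have E (k : 'I_l.+1) : lift i (lift jo k) = lift i' (lift jo' k).
  have := congr1 (@nat_of_ord _) Ei; have := congr1 (@nat_of_ord _) Ei'.
  by move=> /= E1 E2; apply: val_inj; move: E1 E2; rewrite /= /bump /=; lia.
have F (a : 'I_l.+3) (b : 'I_l.+2) :
    push_face a (@vertex R l.+1 \o lift b : cell l l.+1) =
    @vertex R l.+2 \o (lift a \o lift b).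
  by apply/funext => k; rewrite /push_face /= affine_map_vertex.
have Eab : lift i \o lift jo = lift i' \o lift jo' :> ('I_l.+1 -> 'I_l.+3).
  exact/funext/E.
congr (pairing (homotopy_simplexes _) _).
  by rewrite /face !restr_comp -!/(push_face _ _) !F Eab.
apply/funext => v /=; congr phi; apply/funext => t.
rewrite /push_face /= !affine_map_comp; congr affine_map.
have := F i jo; have := F i' jo'; rewrite /push_face => -> ->.
by rewrite Eab.
Qed.

(** In degree 0 the homotopy vanishes and the subdivision is the identity. *)
Lemma homotopy_coboundary0 (s : sing R X 0) (W : zmodType) (phi : cell 0 0 -> W) :
  pairing (homotopy_simplexes s) (coboundary phi) =
  phi (@vertex R 0) - pairing (sd_simplexes u s) phi.
Proof. by rewrite /pairing big_nil big_seq1 mulr1z subrr. Qed.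

(** The transpose of d (H s) = s - sd s - H (d s). *)
Lemma homotopy_coboundary l (s : sing R X l.+1) (W : zmodType)
    (phi : cell l.+1 l.+1 -> W) :
  pairing (homotopy_simplexes s) (coboundary phi) =
  phi (@vertex R l.+1) - pairing (sd_simplexes u s) phi
    - pairing (face_homotopy s) phi.
Proof.
(* By the cone formula it suffices to know that sd t = u * (d t - d (H (d t))),
   which the induction hypothesis provides on each face. *)
have step m (t : sing R X m.+1) (W' : zmodType) (psi : cell m.+1 m.+1 -> W') :
  pairing (sd_simplexes u t) psi =
    coboundary (psi \o join (u t)) (@vertex R m.+1) -
    pairing (face_homotopy t) (coboundary (psi \o join (u t))) ->
  pairing (homotopy_simplexes t) (coboundary psi) =
    psi (@vertex R m.+1) - pairing (sd_simplexes u t) psi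
    - pairing (face_homotopy t) psi.
  move=> ->; rewrite pairing_homotopy coboundary_join.
  have -> : coboundary psi \o join (u t) =
      fun v => psi v - coboundary (psi \o join (u t)) v.
    by apply/funext => v /=; exact: coboundary_join.
  by rewrite pairing_sub !opprB !addrA; congr (_ - _); exact: addrAC.
elim: l => [|l IH] in s W phi *; apply: step; rewrite pairing_sd;
  rewrite pairing_face_homotopy -sumrB.
  apply: eq_bigr => i _.
  by rewrite coboundary_push homotopy_coboundary0 -push_vertex -mulrzBl subKr.
under [RHS]eq_bigr => i _.
  rewrite coboundary_push IH -push_vertex -mulrzBl -addrA -opprD subKr mulrzDl.
  over.
by rewrite big_split /= face_homotopy_faces addr0.
Qed.

End Homotopy.
End Prism.

(** * The chain homotopy *)

Section ChainHomotopy.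
Variables (R : realType) (X : topologicalType).
Variables (K : idomainType) (G : lmodType K).
Variable u : forall l, sing R X l -> stdsimplex R l.
Implicit Types (k l : nat).

Local Notation cell k l := ('I_k.+1 -> stdsimplex R l).

(** The cochain through which formal chains in the domain of s become singular
    chains of X. *)
Definition restriction k l (s : sing R X l) (g : G) (v : cell k l) :
  chain R X G k := single (restr s v) g.

Lemma pairing_restriction_linear k l (s : sing R X l) (L : seq (int * cell k l)) :
  linear (fun g => pairing L (restriction s g)).
Proof.
move=> a g h; rewrite /pairing scaler_sumr -big_split; apply: eq_bigr => nv _ /=.
by rewrite /restriction linearP mulrzDl -scalerMzr.
Qed.

Lemma pairing_restriction k l (s : sing R X l) (L : seq (int * cell k l)) (g : G) :
  pairing L (restriction s g) =
  \sum_(nv <- L) single (restr s nv.2) (g *~ nv.1).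
Proof. by apply: eq_bigr => nv _; rewrite /restriction raddfMz. Qed.

Let faces_linear l (s : sing R X l.+1) :
  linear (fun g : G => \sum_(i < l.+2) single (face s i) ((-1) ^+ i *: g)).
Proof.
move=> a g h; rewrite scaler_sumr -big_split; apply: eq_bigr => i _ /=.
by rewrite !scalerDr scalerA mulrC -scalerA linearP.
Qed.

Lemma boundary_linear l : linear (@boundary R X K G l).
Proof. exact: extension_linear (@faces_linear l). Qed.

HB.instance Definition _ l :=
  GRing.isLinear.Build K _ _ _ (@boundary R X K G l) (@boundary_linear l).

Lemma boundary_single l (s : sing R X l.+1) (g : G) :
  boundary (single s g) = \sum_i single (face s i) g *~ (-1) ^+ i.
Proof.
transitivity (\sum_(i < l.+2) single (face s i) ((-1) ^+ i *: g)).
  exact: (extension_single (@faces_linear l)).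
apply: eq_bigr => i _; rewrite linearZ /= -[i : nat]/(val i).
rewrite -(signr_odd K) -(signr_odd int).
by case: (odd i); rewrite ?scaleN1r ?mulrN1z ?scale1r.
Qed.

Let sd_linear_at l (s : sing R X l) :
  linear (fun g : G =>
    \sum_(nF <- sd_simplexes u s) single (restr s nF.2) (g *~ nF.1)).
Proof.
move=> a g h; rewrite -!pairing_restriction; exact: pairing_restriction_linear.
Qed.

Lemma sd_linear l : linear (@sd R X u K G l).
Proof. exact: extension_linear (@sd_linear_at l). Qed.

HB.instance Definition _ l :=
  GRing.isLinear.Build K _ _ _ (@sd R X u K G l) (@sd_linear l).

Lemma sd_single l (s : sing R X l) (g : G) :
  sd u (single s g) = pairing (sd_simplexes u s) (restriction s g).
Proof.
by rewrite pairing_restriction; exact: (extension_single (@sd_linear_at l)).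
Qed.

Definition homotopy l : chain R X G l -> chain R X G l.+1 :=
  extension (fun s g => pairing (homotopy_simplexes u s) (restriction s g)).

Lemma homotopy_linear l : linear (@homotopy l).
Proof. by apply: extension_linear => s; exact: pairing_restriction_linear. Qed.

HB.instance Definition _ l :=
  GRing.isLinear.Build K _ _ _ (@homotopy l) (@homotopy_linear l).

Lemma homotopy_single l (s : sing R X l) (g : G) :
  homotopy (single s g) = pairing (homotopy_simplexes u s) (restriction s g).
Proof.
by apply: extension_single => t; exact: pairing_restriction_linear.
Qed.

Lemma boundary_restriction k l (s : sing R X l) (g : G) (v : cell k.+1 l) :
  boundary (restriction s g v) = coboundary (restriction s g) v.
Proof.
rewrite boundary_single; apply: eq_bigr => i _.
rewrite /face restr_comp /restriction; congr (single (restr s _) g *~ _).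
by apply/funext => j; rewrite /= affine_map_vertex.
Qed.

Lemma boundary_pairing k l (s : sing R X l) (g : G) (L : seq (int * cell k.+1 l)) :
  boundary (pairing L (restriction s g)) = pairing L (coboundary (restriction s g)).
Proof.
rewrite raddf_sum; apply: eq_bigr => nv _.
by rewrite raddfMz /= boundary_restriction.
Qed.

Lemma restriction_vertex l (s : sing R X l) (g : G) :
  restriction s g (@vertex R l) = single s g.
Proof. by rewrite /restriction restr_vertex. Qed.

Lemma homotopy_boundary_single l (s : sing R X l.+1) (g : G) :
  homotopy (boundary (single s g)) =
  pairing (face_homotopy u s) (restriction s g).
Proof.
rewrite boundary_single raddf_sum pairing_face_homotopy; apply: eq_bigr => i _.
rewrite raddfMz; congr (_ *~ _); rewrite [LHS]homotopy_single; congr pairing.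
by apply/funext => v; rewrite /restriction /= /face restr_comp.
Qed.

Lemma homotopyE l (c : chain R X G l.+1) :
  c - sd u c = homotopy (boundary c) + boundary (homotopy c).
Proof.
elim/chain_single_ind: c => [|s g c IH].
  by rewrite !linear0 !addr0.
rewrite !linearD /= addrACA IH [RHS]addrACA; congr (_ + _).
rewrite sd_single homotopy_single homotopy_boundary_single boundary_pairing.
by rewrite homotopy_coboundary restriction_vertex [RHS]addrC subrK.
Qed.

Lemma homotopyE0 (c : chain R X G 0) : c - sd u c = boundary (homotopy c).
Proof.
elim/chain_single_ind: c => [|s g c IH].
  by rewrite !linear0 addr0.
rewrite !linearD /= addrACA IH; congr (_ + _).
by rewrite sd_single homotopy_single boundary_pairing homotopy_coboundary0
  restriction_vertex.
Qed.

(** Only the terms of an expression of the chain by allowable simplexes matter: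
    the faces of these may fail to be allowable, but the homotopy of each simplex
    consists of restrictions of that simplex itself. *)
Lemma homotopy_allowable (F : filtered_space X) (p : perversity F) l
    (c : chain R X G l) :
  (forall s : sing R X l, allowable p s ->
     forall nv, nv \in homotopy_simplexes u s -> allowable p (restr s nv.2)) ->
  allowable_chain p c -> allowable_chain p (homotopy c).
Proof.
move=> simplex_allowable [cs [cs_allowable ->]].
exists [seq (gs.1 *~ nv.1, restr gs.2 nv.2) | gs <- cs,
          nv <- homotopy_simplexes u gs.2]; split.
  move=> _ /allpairsPdep [gs [nv [gs_cs nv_gs ->]]] /=.
  by apply: simplex_allowable => //; exact: cs_allowable.
rewrite raddf_sum big_allpairs_dep; apply: eq_bigr => gs _.
by rewrite /= homotopy_single pairing_restriction.
Qed.

End ChainHomotopy.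

(** * Simplexes and barycentric coordinates *)

Section Simplices.
Variables (R : realType) (m : nat).
Local Notation V := 'rV[R]_m.
Implicit Types (k : nat) (T : {fset V}).

Lemma lincombE k n (p : 'I_k.+1 -> 'rV[R]_n) (t : 'rV[R]_k.+1) :
  lincomb p t = t *m \matrix_i p i.
Proof. by rewrite mulmx_sum_row; apply: eq_bigr => i _; rewrite rowK. Qed.

Definition aff_free k (p : 'I_k.+1 -> V) : Prop :=
  forall w : 'rV[R]_k.+1, \sum_i w 0 i = 0 -> lincomb p w = 0 -> w = 0.

Definition vertex_set k (p : 'I_k.+1 -> V) : {fset V} :=
  [fset p i | i in 'I_k.+1]%fset.

Lemma big_vertex_set k (p : 'I_k.+1 -> V) (W : nmodType) (f : V -> W) :
  injective p -> \sum_(x <- vertex_set p) f x = \sum_i f (p i).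
Proof.
move=> p_inj; transitivity (\sum_(x <- [seq p i | i <- enum 'I_k.+1]) f x).
  apply: perm_big; apply: uniq_perm; first exact: fset_uniq.
    by rewrite map_inj_uniq ?enum_uniq.
  move=> x; apply/imfsetP/mapP => -[i ? ->]; exists i => //=.
  by rewrite mem_enum.
by rewrite big_map big_enum.
Qed.

Lemma aff_free_inj k (p : 'I_k.+1 -> V) : aff_free p -> injective p.
Proof.
move=> p_free i j pij; apply/eqP; apply/negPn/negP => ij.
have sumE (W : lmodType R) (f : 'I_k.+1 -> W) :
    \sum_a (delta_mx 0 i - delta_mx 0 j : 'rV[R]_k.+1) 0 a *: f a = f i - f j.
  rewrite (bigD1 i) //= (bigD1 j) 1?eq_sym //= big1 => [|a /andP[ai aj]].
    rewrite !mxE !eqxx /= (negbTE ij) eq_sym (negbTE ij) subr0 sub0r scale1r.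
    by rewrite scaleN1r addr0.
  by rewrite !mxE (negbTE ai) (negbTE aj) subr0 scale0r.
have := p_free (delta_mx 0 i - delta_mx 0 j).
rewrite /lincomb sumE pij subrr => /(_ _ erefl) E.
have /rowP/(_ i) : delta_mx 0 i - delta_mx 0 j = 0 :> 'rV[R]_k.+1.
  apply: E; have := sumE R^o (fun=> 1); rewrite subrr => {2}<-.
  by apply: eq_bigr => a _; rewrite [RHS]mulr1.
by rewrite !mxE !eqxx (negbTE ij) subr0 => /eqP; rewrite oner_eq0.
Qed.

Lemma vertex_set_simplex k (p : 'I_k.+1 -> V) :
  aff_free p -> is_simplex (vertex_set p).
Proof.
move=> p_free; have p_inj := aff_free_inj p_free; split.
  by apply/fset0Pn; exists (p ord0); apply/imfsetP; exists ord0.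
move=> w w0 wp0 _ /imfsetP[i _ ->].
have /rowP/(_ i) : \row_j w (p j) = 0.
  apply: p_free.
    by rewrite -[RHS]w0 big_vertex_set //; apply: eq_bigr => j _; rewrite mxE.
  by rewrite -[RHS]wp0 big_vertex_set //; apply: eq_bigr => j _; rewrite mxE.
by rewrite !mxE.
Qed.

Lemma sdim_vertex_set k (p : 'I_k.+1 -> V) : injective p -> sdim (vertex_set p) = k.
Proof. by move=> p_inj; rewrite /sdim card_imfset //= size_enum_ord. Qed.

Lemma hull_vertex_set k (p : 'I_k.+1 -> V) : injective p ->
  hull (vertex_set p) = lincomb p @` stdsimplex R k.
Proof.
move=> p_inj; apply/seteqP; split=> [_ [w [w_ge0 w1 ->]]|_ [t [t_ge0 t1] <-]].
  exists (\row_j w (p j)).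
    split=> [i|]; first by rewrite mxE; apply: w_ge0; apply/imfsetP; exists i.
    by rewrite -[RHS]w1 big_vertex_set //; apply: eq_bigr => j _; rewrite mxE.
  by rewrite big_vertex_set //; apply: eq_bigr => j _; rewrite mxE.
pose w x := if [pick i | p i == x] is Some i then t 0 i else 0.
have wE i : w (p i) = t 0 i.
  rewrite /w; case: pickP => [j /eqP/p_inj -> //|/(_ i)].
  by rewrite eqxx.
exists w; split=> [_ /imfsetP[i _ ->]||]; first by rewrite wE.
  by rewrite -[RHS]t1 big_vertex_set //; apply: eq_bigr => j _; rewrite wE.
by rewrite big_vertex_set //; apply: eq_bigr => j _; rewrite wE.
Qed.

Lemma simplex_vertices T : is_simplex T ->
  exists2 p : 'I_(sdim T).+1 -> V, aff_free p & T = vertex_set p.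
Proof.
move=> [T0 T_free].
have cT : #|` T| = (sdim T).+1 by rewrite /sdim prednK // cardfs_gt0.
pose p (i : 'I_(sdim T).+1) := T`_i.
have p_inj : injective p.
  by move=> i j /eqP; rewrite nth_uniq ?cT ?fset_uniq // => /eqP/val_inj.
have Tp : T = vertex_set p.
  apply/fsetP => x; apply/idP/imfsetP => [xT|[i _ ->]]; last first.
    by rewrite mem_nth ?cT.
  have xi : (index x T < (sdim T).+1)%N by rewrite -cT index_mem.
  by exists (Ordinal xi) => //=; rewrite /p nth_index.
exists p => // w w0 wp0; apply/rowP => i; rewrite mxE.
pose v x := if [pick i | p i == x] is Some i then w 0 i else 0.
have vE j : v (p j) = w 0 j.
  rewrite /v; case: pickP => [j' /eqP/p_inj -> //|/(_ j)].
  by rewrite eqxx.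
rewrite -vE; apply: T_free.
- by rewrite Tp big_vertex_set // -[RHS]w0; apply: eq_bigr => j _; rewrite vE.
- by rewrite Tp big_vertex_set // -[RHS]wp0; apply: eq_bigr => j _; rewrite vE.
by rewrite mem_nth ?cT.
Qed.

Lemma lincombD k n (p : 'I_k.+1 -> 'rV[R]_n) t t' :
  lincomb p (t + t') = lincomb p t + lincomb p t'.
Proof. by rewrite !lincombE mulmxDl. Qed.

Lemma lincombZ k n (p : 'I_k.+1 -> 'rV[R]_n) (a : R) t :
  lincomb p (a *: t) = a *: lincomb p t.
Proof. by rewrite !lincombE scalemxAl. Qed.

Lemma lincombB k n (p : 'I_k.+1 -> 'rV[R]_n) t t' :
  lincomb p (t - t') = lincomb p t - lincomb p t'.
Proof. by rewrite !lincombE mulmxBl. Qed.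

Lemma norm_coord n (x : 'rV[R]_n) j : `|x 0 j| <= `|x|.
Proof.
rewrite -[leRHS]/(mx_norm x) mx_normrE.
exact: (le_bigmax _ (fun ij => `|x ij.1 ij.2|) (0, j)).
Qed.

Lemma lincomb_continuous k n (p : 'I_k.+1 -> 'rV[R]_n) : continuous (lincomb p).
Proof.
apply: continuous_big => [|i _ t]; first exact: add_continuous.
by apply: cvgZr_tmp; [exact: (nbhs_filter t)|exact: coord_continuous].
Qed.

Lemma stdsimplex_compact k : compact (stdsimplex R k).
Proof.
apply: bounded_closed_compact.
  exists 1; split=> // M M1 x [x_ge0 x1] /=.
  rewrite -[leLHS]/(mx_norm x) mx_normrE; apply: bigmax_le => [|[i j] _ /=].
    by rewrite (le_trans _ (ltW M1)).
  rewrite ord1 ger0_norm // (le_trans _ (ltW M1)) // -x1 (bigD1 j) //=.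
  by rewrite lerDl sumr_ge0.
have -> : stdsimplex R k =
    (\bigcap_i [set x : 'rV[R]_k.+1 | 0 <= x 0 i]) `&`
    ((fun x : 'rV[R]_k.+1 => \sum_i x 0 i) @^-1` [set 1]).
  apply/seteqP; split=> x [] x0 x1; split=> // i; first by move=> _; exact: x0.
  exact: x0.
apply: closedI.
  apply: closed_bigI => i _.
  apply: (@closed_comp _ _ (fun x : 'rV[R]_k.+1 => x 0 i) [set r | 0 <= r]).
    by move=> x _; exact: coord_continuous.
  exact: closed_ge.
apply: closed_comp => [x _|]; last exact: closed_eq.
apply: continuous_big => [|i _ t]; first exact: add_continuous.
exact: coord_continuous.
Qed.

Lemma hull_compact T : is_simplex T -> compact (hull T).
Proof.
move=> /simplex_vertices [p /aff_free_inj p_inj ->].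
rewrite hull_vertex_set //; apply: continuous_compact; last exact: stdsimplex_compact.
by apply: continuous_subspaceT; exact: lincomb_continuous.
Qed.

Lemma hull_convex T (a b : V) (t : R) : hull T a -> hull T b -> 0 <= t <= 1 ->
  hull T ((1 - t) *: a + t *: b).
Proof.
move=> [w [w_ge0 w1 ->]] [v [v_ge0 v1 ->]] /andP[t0 t1].
exists (fun x => (1 - t) * w x + t * v x); split=> [x xT||].
- by rewrite addr_ge0 // mulr_ge0 ?subr_ge0 ?w_ge0 ?v_ge0.
- by rewrite big_split /= -!mulr_sumr w1 v1 !mulr1 subrK.
rewrite !scaler_sumr -big_split; apply: eq_bigr => x _ /=.
by rewrite !scalerA scalerDl.
Qed.

(** Appending a coordinate 1 to each vertex turns affine independence into linear
    independence, so barycentric coordinates are a linear function of the point. *)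
Lemma barycentric_lipschitz k (p : 'I_k.+1 -> V) : aff_free p ->
  exists2 C : R, 0 < C & forall z : 'rV[R]_k.+1, \sum_i z 0 i = 0 ->
    forall i, `|z 0 i| <= C * `|lincomb p z|.
Proof.
move=> p_free; pose N := row_mx (\matrix_i p i) (const_mx 1 : 'M[R]_(k.+1, 1)).
have zN (z : 'rV[R]_k.+1) : z *m N = row_mx (lincomb p z) (const_mx (\sum_i z 0 i)).
  rewrite mul_mx_row lincombE; congr row_mx; apply/matrixP => i j.
  by rewrite !mxE ord1; apply: eq_bigr => a _; rewrite mxE mulr1.
have N_free : row_free N.
  apply: inj_row_free => z; rewrite zN -row_mx0 => /eq_row_mx [pz0 z0].
  apply: p_free => //; have /matrixP/(_ 0 0) := z0; by rewrite !mxE.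
pose A := usubmx (pinvmx N).
exists (1 + \sum_i \sum_j `|A j i|).
  by rewrite ltr_pwDl // sumr_ge0 // => i _; rewrite sumr_ge0.
move=> z z0 i.
have zE : z = lincomb p z *m A.
  rewrite -[LHS](mulmxKp N_free) zN z0 -[pinvmx N]vsubmxK mul_row_col.
  rewrite [X in _ + X](_ : _ = 0) ?addr0 //.
  by rewrite (_ : const_mx 0 = 0) ?mul0mx //; apply/matrixP => a b; rewrite !mxE.
rewrite {1}zE; move: (lincomb p z) => x.
rewrite mxE (le_trans (ler_norm_sum _ _ _)) //.
rewrite mulrDl mul1r ler_wpDl // mulr_suml (bigD1 i) //= ler_wpDr //.
  by apply: sumr_ge0 => j _; rewrite mulr_ge0 // sumr_ge0.
rewrite mulr_suml; apply: ler_sum => j _.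
by rewrite normrM mulrC ler_wpM2l // norm_coord.
Qed.

(** * Finite unions of simplexes *)

(** Moving away from a only threatens the coordinates that are positive at a;
    these stay nonnegative as long as the distance to a is at most their minimum
    divided by the Lipschitz constant. *)
Lemma radial_extension T (a : V) : is_simplex T -> hull T a ->
  exists2 e : R, 0 < e & forall x s, hull T x -> 1 <= s -> s * `|x - a| <= e ->
    hull T (a + s *: (x - a)).
Proof.
move=> /simplex_vertices [p p_free ->].
have p_inj := aff_free_inj p_free; rewrite hull_vertex_set //.
move=> [t [t_ge0 t1] <-]; have [C C_gt0 lipC] := barycentric_lipschitz p_free.
pose d : R := \big[Num.min/1]_(i | 0 < t 0 i) t 0 i.
have d_gt0 : 0 < d by apply: lt_bigmin.
exists (d / C); first exact: divr_gt0.
move=> _ s [x [x_ge0 x1] <-] s1; rewrite ler_pdivlMr // -lincombB => sd.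
have s_ge0 : 0 <= s by rewrite (le_trans _ s1).
exists (t + s *: (x - t)); last by rewrite lincombD lincombZ.
have dif0 : \sum_i (x - t) 0 i = 0.
  under eq_bigr do rewrite !mxE.
  by rewrite sumrB x1 t1 subrr.
split=> [i|].
  rewrite mxE [X in _ + X]mxE.
  have := t_ge0 i; rewrite le_eqVlt => /predU1P[/esym ti0|ti_gt0].
    by rewrite ti0 add0r mulr_ge0 // !mxE ti0 subr0.
  have di : d <= t 0 i by apply: (bigmin_le_cond _ (fun i => t 0 i)).
  have lip : s * `|(x - t) 0 i| <= d.
    rewrite (le_trans _ sd) // -mulrA ler_wpM2l // mulrC; exact: lipC.
  rewrite -lerBlDl sub0r lerNl -mulrN (le_trans _ di) // (le_trans _ lip) //.
  by rewrite ler_wpM2l // -normrN ler_norm.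
under eq_bigr do rewrite mxE [X in _ + X]mxE.
by rewrite big_split /= -mulr_sumr dif0 mulr0 addr0.
Qed.

Lemma hull_separated T (a : V) : is_simplex T -> ~ hull T a ->
  exists2 e : R, 0 < e & forall x, hull T x -> e <= `|x - a|.
Proof.
move=> /hull_compact T_compact Ta.
have T_closed : closed (hull T).
  apply: compact_closed => //; exact: norm_hausdorff.
have : nbhs a (~` hull T) by apply: open_nbhs_nbhs; split=> //; exact: closed_openC.
move=> /nbhs_normP[e /= e_gt0 eT]; exists e => // x xT; rewrite leNgt.
by apply/negP => xa; apply: (eT x); rewrite //= /ball_ distrC.
Qed.

(** One radius serves for all the simplexes, and is so small that those not
    containing a stay farther away. *)
Lemma finite_radial_extension (F : seq {fset V}) (a : V) :
  (forall T, T \in F -> is_simplex T) ->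
  exists2 e : R, 0 < e & forall T x, T \in F -> hull T x -> `|x - a| < e ->
    hull T a /\
    forall s, 1 <= s -> s * `|x - a| <= e -> hull T (a + s *: (x - a)).
Proof.
elim: F => [|T F IH] simplexF; first by exists 1.
have [T' T'F|e e_gt0 eF] := IH; first by apply: simplexF; rewrite inE T'F orbT.
have simplexT : is_simplex T by apply: simplexF; rewrite mem_head.
have [d d_gt0 dT] : exists2 d : R, 0 < d & forall x, hull T x -> `|x - a| < d ->
    hull T a /\
    forall s, 1 <= s -> s * `|x - a| <= d -> hull T (a + s *: (x - a)).
  have [Ta|Ta] := pselect (hull T a).
    have [d d_gt0 dT] := radial_extension simplexT Ta; exists d => // x xT _.
    by split=> // s; exact: dT.
  have [d d_gt0 dT] := hull_separated simplexT Ta; exists d => // x /dT.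
  by rewrite leNgt => /negP.
exists (Num.min d e); first by rewrite lt_min d_gt0.
move=> T' x; rewrite inE lt_min => /predU1P[->|T'F] xT' /andP[xd xe].
  have [Ta radT] := dT _ xT' xd; split=> // s s1.
  by rewrite le_min => /andP[? _]; exact: radT.
have [Ta radT] := eF _ _ T'F xT' xe; split=> // s s1.
by rewrite le_min => /andP[_ ?]; exact: radT.
Qed.

Lemma dist_continuous (W : normedModType R) (a : W) :
  continuous (fun x : W => `|x - a|).
Proof.
by move=> x; apply: cvg_norm; apply: cvgB; [exact: cvg_id|exact: cvg_cst].
Qed.

(** The link of a is the sphere of a small radius, restricted to the simplexes
    that contain a. *)
Lemma union_polyhedron (F : seq {fset V}) :
  (forall T, T \in F -> is_simplex T) ->
  polyhedron (\bigcup_(T in [set` F]) hull T).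
Proof.
move=> simplexF a Pa; have [e e_gt0 eF] := finite_radial_extension a simplexF.
pose Fa := [seq T <- F | `[< hull T a >]].
have FaP T : T \in Fa -> hull T a /\ T \in F.
  by rewrite mem_filter => /andP[/asboolP].
pose L := \bigcup_(T in [set` Fa]) (hull T `&` [set x | `|x - a| = e]).
exists L; split.
- rewrite /L bigcup_seq big_seq; apply: bigsetU_compact => T /FaP [_ TF].
  apply: compact_closedI; first exact/hull_compact/simplexF.
  rewrite -[X in closed X]/((fun x : V => `|x - a| : R) @^-1` [set e]).
  apply: closed_comp => [x _|]; first exact: (@dist_continuous 'rV[R]_m).
  exact: closed_eq.
- move=> b b' t t' [T _ [_ /= be]] [T' _ [_ /= be']] /andP[t_gt0 _] /andP[t'_gt0 _].
  have rayE c s : (1 - s) *: a + s *: c = a + s *: (c - a) :> V.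
    by rewrite scalerBl scale1r scalerBr addrAC -addrA.
  rewrite !rayE => /addrI bb'.
  have tt' : t = t'.
    apply: (mulIf (lt0r_neq0 e_gt0)).
    have := congr1 Num.norm bb'; rewrite !normrZ be be'.
    by rewrite !ger0_norm // ltW.
  split=> //; move: bb'; rewrite -tt' => /(scalerI (lt0r_neq0 t_gt0)).
  exact: addIr.
- move=> x [->|[b [T TFa [Tb _]] [t t01 ->]]].
    exact: Pa.
  have [Ta TF] := FaP _ TFa.
  by exists T => //; exact: hull_convex.
have : \forall x \near a, `|x - a| < e.
  by apply/nbhs_normP; exists e => // x /=; rewrite distrC.
apply: filterS => x xe [T TF xT].
have [Ta radT] := eF _ _ TF xT xe.
have [->|xa] := eqVneq x a; first by left.
have d_gt0 : 0 < `|x - a| by rewrite normr_gt0 subr_eq0.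
right; exists (a + (e / `|x - a|) *: (x - a)).
  exists T; first by rewrite /= mem_filter TF andbT; exact/asboolP.
  split.
    apply: radT; first by rewrite ler_pdivlMr // mul1r ltW.
    by rewrite divfK // gt_eqF.
  by rewrite /= addrAC subrr add0r normrZ ger0_norm ?divr_ge0 ?ltW // divfK // gt_eqF.
exists (`|x - a| / e).
  by rewrite divr_ge0 ?(ltW d_gt0) ?(ltW e_gt0) //= ler_pdivrMr // mul1r ltW.
rewrite scalerDr scalerA -[e / _]invf_div divff; last first.
  by rewrite mulf_neq0 ?invr_neq0 // gt_eqF.
by rewrite scale1r addrA -scalerDl subrK scale1r addrC subrK.
Qed.

(** The simplexes may overlap, since a triangulation is only asked to be a locally
    finite cover by simplexes. *)
Lemma dim_le_union (F : seq {fset V}) (A : set V) (d : \bar int) :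
  (forall T, T \in F -> is_simplex T /\ (sdime T <= d)%E) ->
  A `<=` \bigcup_(T in [set` F]) hull T ->
  dim_le A d.
Proof.
move=> simplexF AF; exists (\bigcup_(T in [set` F]) hull T) => //; split.
  by apply: union_polyhedron => T /simplexF [].
exists [set` F]; last by move=> T /simplexF [].
split=> // [T /simplexF []//|x _]; exists setT; first exact: filterT.
apply: (@sub_finite_set _ _ [set` F]); first by move=> T [].
exact: finite_seq.
Qed.

(** A region of bounded barycentric coordinates lies in an enlarged simplex,
    obtained from the original one by a homothety at its barycentre b. A point of
    coordinates w has coordinates (w + c) / lam in the enlarged simplex. *)
Lemma enclosing_simplex k (p : 'I_k.+1 -> V) (c : R) : aff_free p -> 0 <= c ->
  exists T, [/\ is_simplex T, sdim T = k &
    forall w : 'rV[R]_k.+1, \sum_i w 0 i = 1 -> (forall i, - c <= w 0 i) ->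
      hull T (lincomb p w)].
Proof.
move=> p_free c_ge0; pose n : R := k.+1%:R.
have n_gt0 : 0 < n by rewrite ltr0n.
pose lam := 1 + c * n.
have lam_gt0 : 0 < lam by rewrite ltr_pwDl // mulr_ge0 // ltW.
pose b := n^-1 *: \sum_j p j; pose q i := lam *: p i + (1 - lam) *: b.
have qE z : lincomb q z = lam *: lincomb p z + ((1 - lam) * \sum_i z 0 i) *: b.
  rewrite /lincomb mulr_sumr scaler_suml scaler_sumr -big_split.
  apply: eq_bigr => i _ /=.
  by rewrite scalerDr !scalerA mulrC [_ * (1 - lam)]mulrC.
have q_free : aff_free q.
  move=> w w0; rewrite qE w0 mulr0 scale0r addr0 => /eqP.
  by rewrite scaler_eq0 gt_eqF //= => /eqP; exact: p_free.
have q_inj := aff_free_inj q_free.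
exists (vertex_set q); split; first exact: vertex_set_simplex.
  exact: sdim_vertex_set.
move=> w w1 wc; rewrite hull_vertex_set //.
exists (lam^-1 *: (w + const_mx c)).
  split=> [i|].
    rewrite mxE mulr_ge0 ?invr_ge0 ?(ltW lam_gt0) // mxE [X in _ + X]mxE.
    by rewrite -lerBlDr sub0r.
  under eq_bigr do rewrite mxE mxE [X in _ + X]mxE.
  rewrite -mulr_sumr big_split /= w1 sumr_const card_ord -mulr_natr.
  by rewrite mulVf // gt_eqF.
rewrite qE lincombZ scalerA divff ?gt_eqF // scale1r lincombD -addrA.
rewrite [X in _ + X](_ : _ = 0) ?addr0 //.
have -> : \sum_i (lam^-1 *: (w + const_mx c)) 0 i = 1.
  under eq_bigr do rewrite mxE mxE [X in _ + X]mxE.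
  rewrite -mulr_sumr big_split /= w1 sumr_const card_ord -mulr_natr.
  by rewrite mulVf // gt_eqF.
rewrite mulr1 /b scalerA; under [lincomb _ _]eq_bigr do rewrite mxE.
rewrite -scaler_sumr -scalerDl opprD addrA subrr sub0r mulNr mulfK ?gt_eqF //.
by rewrite subrr scale0r.
Qed.

End Simplices.

(** * Preimages under affine maps with one-dimensional fibres *)

Section Preimages.
Variable R : realType.
Implicit Types (k l n : nat).

Definition spanning k n (v : 'I_k.+1 -> 'rV[R]_n) : Prop :=
  forall y, exists t, y = lincomb v t.

Lemma spanning_kernel n (v : 'I_n.+1 -> 'rV[R]_n) : spanning v ->
  exists2 z : 'rV[R]_n.+1, z != 0 /\ lincomb v z = 0 &
    forall x, lincomb v x = 0 -> exists c, x = c *: z.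
Proof.
move=> v_span; pose M := \matrix_i v i.
have M_full : row_full M.
  apply/row_fullP; pose B := \matrix_i projT1 (cid (v_span (delta_mx 0 i))).
  exists B; apply/row_matrixP => i; rewrite row_mul rowK row1 -lincombE.
  by case: cid => t /= <-.
have rank_ker : \rank (kermx M) = 1%N.
  by rewrite mxrank_ker (eqP M_full) subSnn.
have /row_subPn[i ker_i] : ~~ (kermx M <= (0 : 'M[R]_n.+1))%MS.
  by rewrite submx0 -mxrank_eq0 rank_ker.
exists (row i (kermx M)); first split.
- by move: ker_i; rewrite submx0.
- by rewrite lincombE -row_mul mulmx_ker row0.
move=> x; rewrite lincombE => /sub_kermxP xM; apply/sub_rVP.
apply: (submx_trans xM).
have := mxrank_leqif_sup (row_sub i (kermx M)); rewrite rank_ker => -[_ <-].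
by rewrite eqn_leq rank_leq_row lt0n mxrank_eq0 -submx0.
Qed.

(** The points above the affine span of T form the affine span of lifts s (p j) of
    its vertices, extended in a kernel direction z. Inside the standard simplex
    the coordinate along z is bounded, so one enlarged simplex suffices. *)
Lemma simplex_preimage n (v : 'I_n.+1 -> 'rV[R]_n) (T : {fset 'rV[R]_n}) :
  spanning v -> is_simplex T ->
  exists T', [/\ is_simplex T', sdim T' = (sdim T).+1 &
    forall t, stdsimplex R n t -> hull T (lincomb v t) -> hull T' t].
Proof.
move=> v_span /simplex_vertices [p p_free ET]; rewrite [X in hull X]ET.
have p_inj := aff_free_inj p_free; rewrite hull_vertex_set //.
move: (sdim T) => k in p p_free p_inj {ET} *.
have [z [z_neq0 vz0] kerE] := spanning_kernel v_span.
pose s y := projT1 (cid (v_span y)).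
have sE y : lincomb v (s y) = y by rewrite /s; case: cid.
(* The extra vertex is a translate of a lift by z, so that q remains affinely
   independent; [tl w] collects the coordinates with respect to the lifts. *)
pose q (i : 'I_k.+2) :=
  if unlift ord0 i is Some j then s (p j) else s (p ord0) + z.
pose tl (w : 'rV[R]_k.+2) : 'rV[R]_k.+1 :=
  \row_j (w 0 (lift ord0 j) + w 0 ord0 * (j == ord0)%:R).
have head_sum (W : lmodType R) (c : R) (f : 'I_k.+1 -> W) :
    \sum_j (c * (j == ord0)%:R) *: f j = c *: f ord0.
  rewrite (bigD1 ord0) //= mulr1 big1 ?addr0 // => j /negbTE ->.
  by rewrite mulr0 scale0r.
have qE w : lincomb q w = w 0 ord0 *: z + lincomb (s \o p) (tl w).
  transitivity (w 0 ord0 *: z +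
      (w 0 ord0 *: s (p ord0) + \sum_j w 0 (lift ord0 j) *: s (p j))).
    rewrite /lincomb big_ord_recl {1}/q unlift_none scalerDr addrAC addrC addrA.
    rewrite -addrA; congr (_ + (_ + _)).
    by apply: eq_bigr => j _; rewrite /q liftK.
  congr (_ + _); rewrite -(head_sum _ (w 0 ord0) (fun j => s (p j))) -big_split.
  by apply: eq_bigr => j _; rewrite /= mxE scalerDl addrC.
have tl_sum w : \sum_j tl w 0 j = \sum_i w 0 i.
  rewrite [RHS]big_ord_recl addrC; under eq_bigr do rewrite mxE.
  rewrite big_split /=; congr (_ + _).
  rewrite (bigD1 ord0) //= mulr1 big1 ?addr0 // => j /negbTE ->.
  exact: mulr0.
have vsE x : lincomb v (lincomb (s \o p) x) = lincomb p x.
  rewrite lincombE mulmx_suml; apply: eq_bigr => j _.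
  by rewrite -lincombE lincombZ /= sE.
have q_free : aff_free q.
  move=> w w0 qw0; have tl0 : tl w = 0.
    apply: p_free; rewrite ?tl_sum // -vsE.
    have := congr1 (lincomb v) qw0; rewrite qE lincombD lincombZ vz0 scaler0.
    by rewrite add0r => ->; rewrite lincombE mul0mx.
  have w00 : w 0 ord0 = 0.
    move: qw0; rewrite qE tl0 [lincomb _ 0]lincombE mul0mx addr0 => /eqP.
    by rewrite scaler_eq0 (negbTE z_neq0) orbF => /eqP.
  apply/rowP => i; rewrite mxE; case: (unliftP ord0 i) => [j|] -> //.
  by have /rowP/(_ j) := tl0; rewrite !mxE w00 mul0r addr0.
have [i zi] : exists i, z 0 i != 0.
  apply/existsP; rewrite -negb_forall; apply: contra z_neq0 => /forallP z0.
  by apply/eqP/rowP => i; rewrite mxE; apply/eqP/z0.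
(* Both terms of the difference c z = t - sum_j x_j s (p j) have a bounded i-th
   coordinate. *)
pose C := (1 + \sum_j `|s (p j) 0 i|) / `|z 0 i|.
have C_ge0 : 0 <= C by rewrite divr_ge0 // addr_ge0 // sumr_ge0.
have [T' [simplexT' dimT' T'E]] := enclosing_simplex q_free (addr_ge0 C_ge0 ler01).
exists T'; split=> // t [t_ge0 t1] [x [x_ge0 x1] xE].
have le1 n' (y : 'rV[R]_n'.+1) (j : 'I_n'.+1) :
    (forall j, 0 <= y 0 j) -> \sum_j y 0 j = 1 -> `|y 0 j| <= 1.
  move=> y_ge0 <-; rewrite ger0_norm // (bigD1 j) //= lerDl.
  by rewrite sumr_ge0.
have [c cE] : exists c, t - lincomb (s \o p) x = c *: z.
  by apply: kerE; rewrite lincombB vsE xE subrr.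
have c_le : `|c| <= C.
  rewrite /C ler_pdivlMr ?normr_gt0 // -normrM.
  have /rowP/(_ i) := cE; rewrite [in RHS]mxE => <-; rewrite mxE.
  apply: (le_trans (ler_normD _ _)); apply: lerD; first exact: le1.
  rewrite mxE normrN summxE; apply: (le_trans (ler_norm_sum _ _ _)).
  apply: ler_sum => j _; rewrite mxE normrM -[leRHS]mul1r ler_wpM2r //.
  exact: le1.
pose w : 'rV[R]_k.+2 :=
  \row_a if unlift ord0 a is Some j then x 0 j - c * (j == ord0)%:R else c.
have w0 : w 0 ord0 = c by rewrite mxE unlift_none.
have tlw : tl w = x by apply/rowP => j; rewrite mxE w0 mxE liftK subrK.
have -> : t = lincomb q w by rewrite qE w0 tlw -cE subrK.
have c_bounds : - C <= c <= C by rewrite -ler_norml.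
apply: T'E => [|a]; first by rewrite -tl_sum tlw.
rewrite mxE; case: unlift => [j|]; last by have /andP[? ?] := c_bounds; lra.
have := x_ge0 j; have /andP[? ?] := c_bounds.
by case: (j == ord0); rewrite ?mulr1 ?mulr0; lra.
Qed.

End Preimages.

(** * The vertices of the homotopy span *)

Section Spanning.
Variables (R : realType) (X : topologicalType).
Implicit Types (k l : nat).

Lemma std_vertices_inj l : injective (fun i => delta_mx 0 i : 'rV[R]_l.+1).
Proof.
move=> i j /rowP /(_ i); rewrite !mxE !eqxx /=.
by case: eqP => // _ /eqP; rewrite oner_eq0.
Qed.

Lemma sinterior_coord_gt0 l (x : 'rV[R]_l.+1) i :
  sinterior (std_vertices R l) x -> 0 < x 0 i.
Proof.
move=> [x_std x_bd]; rewrite lt_neqAle eq_sym andbC.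
have [-> _ /=] : stdsimplex R l x by rewrite -hull_std_vertices.
apply/eqP => xi0; apply: x_bd.
have iV : delta_mx 0 i \in std_vertices R l by apply/imfsetP; exists i.
exists (delta_mx 0 i) => //.
have [w [w_ge0 w1 xE]] := x_std.
have wi0 : w (delta_mx 0 i) = 0.
  rewrite -xi0 xE (big_vertex_set _ (@std_vertices_inj l)) summxE.
  rewrite (bigD1 i) //= !mxE !eqxx mulr1 big1 ?addr0 // => j ji.
  by rewrite !mxE eq_sym (negbTE ji) andbF mulr0.
exists w; split=> [v||].
- by rewrite in_fsetD1 => /andP[_]; exact: w_ge0.
- by rewrite -[RHS]w1 [RHS](big_fsetD1 _ iV) /= wi0 add0r.
- by rewrite xE (big_fsetD1 _ iV) /= wi0 scale0r add0r.
Qed.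

Lemma spanning_join k l (a : stdsimplex R l) (v : 'I_k.+1 -> stdsimplex R l) :
  (forall y, exists c t, y = c *: val a + lincomb (val \o v) t) ->
  spanning (val \o join a v).
Proof.
move=> av_span y; have [c [t ->]] := av_span y.
exists (\row_i if unlift ord0 i is Some j then t 0 j else c).
rewrite [RHS]big_ord_recl mxE unlift_none /= /join unlift_none.
by congr (_ + _); apply: eq_bigr => j _; rewrite mxE /= liftK.
Qed.

Lemma lincomb_push k l (i : 'I_l.+2) (v : 'I_k.+1 -> stdsimplex R l) t :
  lincomb (val \o push_face i v) t = face_map i (lincomb (val \o v) t).
Proof.
rewrite /face_map [in RHS]lincombE [lincomb (val \o v) t]/lincomb mulmx_suml.
apply: eq_bigr => j _.
by rewrite -scalemxAl -lincombE.
Qed.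

Lemma face_mapE l (i : 'I_l.+2) (y : 'rV[R]_l.+2) : y 0 i = 0 ->
  y = face_map i (\row_j y 0 (lift i j)).
Proof.
move=> yi0; rewrite {1}[y]row_sum_delta (bigD1_ord i) //= yi0 scale0r add0r.
by apply: eq_bigr => j _; rewrite mxE.
Qed.

(** Subtracting a multiple of the interior point u moves any vector into the
    hyperplane of the i-th face, which the vertices of the face term span. *)
Lemma homotopy_simplexes_spanning (u : forall l, sing R X l -> stdsimplex R l) :
  (forall l (s : sing R X l), sinterior (std_vertices R l) (val (u l s))) ->
  forall l (s : sing R X l) nv, nv \in homotopy_simplexes u s ->
    spanning (val \o nv.2).
Proof.
move=> u_int; elim=> [//|l IH] s nv; rewrite inE => /predU1P[->|].
  apply: spanning_join => y; exists 0, y; rewrite scale0r add0r.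
  exact: row_sum_delta.
move=> /mapP[nv1 /flattenP[L /mapP[i _ ->] /mapP[nv2 nv2_in ->]] ->] /=.
have ui_gt0 := sinterior_coord_gt0 i (u_int _ s).
apply: spanning_join => y; exists (y 0 i / (val (u _ s)) 0 i).
pose y' := y - (y 0 i / (val (u _ s)) 0 i) *: val (u _ s).
have y'i0 : y' 0 i = 0 by rewrite !mxE divfK ?subrr // gt_eqF.
have [t tE] := IH _ _ nv2_in (\row_j y' 0 (lift i j)).
by exists t; rewrite lincomb_push -tE -face_mapE // addrC subrK.
Qed.

End Spanning.

(** * Allowability *)

Section Allowability.
Variables (R : realType) (X : topologicalType) (F : filtered_space X).
Variable T : simplicial_system R F.
Implicit Types (l : nat).

Lemma dim_leW m (A : set 'rV[R]_m) (d d' : \bar int) :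
  (d <= d')%E -> dim_le A d -> dim_le A d'.
Proof.
move=> dd' [Q AQ [polyQ [K triK dimK]]]; exists Q => //; split=> //.
by exists K => // C /dimK /le_trans; apply.
Qed.

Lemma has_dim_le m (A : set 'rV[R]_m) (e d : \bar int) :
  has_dim A e -> dim_le A d -> A = set0 \/ (e <= d)%E.
Proof.
case: e => [k /= [_ not_k1]|//|/= ->] Ad; last by left.
right; rewrite leNgt; apply/negP => dk; apply: not_k1.
apply: dim_leW Ad; case: d dk => [r||_].
- by rewrite lte_fin lee_fin; lia.
- by rewrite ltNge leey.
- exact: leNye.
Qed.

(** The triangulated polyhedron given by [dim_le] may be infinite and not closed.
    The envelope is finite, and its dimension being that of A, it obeys every
    bound on the dimension of A. *)
Lemma envelope_simplexes m (A : set 'rV[R]_m) (E : seq {fset 'rV[R]_m}) d :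
  envelope A E -> dim_le A d ->
  exists2 E' : seq {fset 'rV[R]_m},
    (forall C, C \in E' -> is_simplex C /\ (sdime C <= d)%E) &
    A `<=` \bigcup_(C in [set` E']) hull C.
Proof.
move=> [simplexE AE dimA] Ad; have [->|Ed] := has_dim_le dimA Ad.
  by exists [::] => // C.
exists E => // C CE; split; first exact: simplexE.
by apply: le_trans Ed; apply: le_bigmax_seq.
Qed.

(** Allowability survives composition with an affine map that lowers the
    dimension by 1 and has one-dimensional fibres. *)
Lemma allowable_restr (p : perversity F) l (s : sing R X l)
    (v : 'I_l.+2 -> stdsimplex R l) :
  spanning (val \o v) -> allowable p s -> allowable p (restr s v).
Proof.
move=> v_span s_allow S S_sing.
have [E simplexE AE] := envelope_simplexes (envP T s S) (s_allow S S_sing).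
have {simplexE} [E' simplexE' AE'] : exists2 E' : seq {fset 'rV[R]_l.+2},
    (forall C, C \in E' -> is_simplex C /\ (sdime C <=
       (l.+1)%:Z%:E - 2%:Z%:E - dual_perversity p S)%E) &
    forall t, stdsimplex R l.+1 t ->
      (\bigcup_(C in [set` E]) hull C) (lincomb (val \o v) t) ->
      (\bigcup_(C in [set` E']) hull C) t.
  elim: E simplexE {AE} => [|C E IH] simplexE.
    by exists [::] => // t _ [].
  have [C'|E' simplexE' EE'] := IH.
    by move=> C'E; apply: simplexE; rewrite inE C'E orbT.
  have [simplexC dimC] : is_simplex C /\ _ := simplexE C (mem_head _ _).
  have [C' [simplexC' dimC' CC']] := simplex_preimage v_span simplexC.
  exists (C' :: E').
    move=> D; rewrite inE => /predU1P[->|]; last exact: simplexE'.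
    split=> //; move: dimC; rewrite /sdime dimC'.
    by case: (dual_perversity p S) => [r||] //; rewrite !lee_fin; lia.
  move=> t t_std [D]; rewrite /= inE => /predU1P[->|DE] tD.
    by exists C'; rewrite /= ?mem_head //; exact: CC'.
  have [|D' /= D'E' tD'] := EE' t t_std; first by exists D.
  by exists D' => //=; rewrite inE D'E' orbT.
apply: dim_le_union simplexE' _ => _ [t /= St <-].
apply: AE'; first exact: set_valP.
by apply: AE; exists (affine_map v t).
Qed.

End Allowability.

Theorem proposition4p8 (R : realType) (K : idomainType) (hK : dedekind K)
    (G : lmodType K) (X : topologicalType) (F : filtered_space X)
    (p : perversity F) (hF : locally_finite F) (T : simplicial_system R F)
    (B : pseudo_barycentric_system T) (hB : adapted p B) :
  exists H : forall l, {linear chain R X G l -> chain R X G l.+1},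
    [/\ forall c : chain R X G 0,
          c - sd (pbary B) c = boundary (H 0%N c),
        forall l (c : chain R X G l.+1),
          c - sd (pbary B) c = H l (boundary c) + boundary (H l.+1 c) &
        forall l (c : chain R X G l),
          allowable_chain p c -> allowable_chain p (H l c)].
Proof.
exists (fun l => homotopy (G := G) (pbary B) (l := l)); split.
- exact: homotopyE0.
- exact: homotopyE.
move=> l c; apply: homotopy_allowable => s s_allow nv nv_in.
apply: (allowable_restr T) s_allow.
exact: homotopy_simplexes_spanning (pbary_interior B) _ _ _ nv_in.
Qed.
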